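(* Let $0<\widetilde\omega_1<\widetilde\omega_2$ and $\mu>2+\sqrt3$. Consider the problem of minimizing $p\mapsto\max_{\widetilde\omega_1\le\widetilde\omega\le\widetilde\omega_2}\rho(\widetilde\omega,p)$ over $p>0$; ''the minimum'' below means the minimum of this problem. Set $p^*=\sqrt{2\mu\,\widetilde\omega_1\widetilde\omega_2}$ and $k_r=\widetilde\omega_2/\widetilde\omega_1$, and let $R_c$, $h_1(\mu)$, $h_2(\mu)$, $I_l$, $I_c$, $I_r$ be as defined in the context. Then: (i) If $k_r>h_2(\mu)$, then one value of the parameter $p$ attaining the minimum is $p^*\in I_c$. This optimized parameter $p^*$ is unique when $\rho(\widetilde\omega_1,p^* )\ge R_c$. Otherwise, the minimum is also attained for any $p$ chosen in a closed interval around $p^*$. (ii) If $h_1(\mu)<k_r\le h_2(\mu)$, the minimum is attained for any $p$ chosen in a closed interval around $p^*$. (iii) If $k_r\le h_1(\mu)$, then the minimum is attained with two distinct values $p_l$ and $p_r$, which can be obtained by solving $\rho(\widetilde\omega_1,p)=\rho(\widetilde\omega_2,p)$ in the two intervals $I_l$ and $I_r$ respectively. Furthermore, these two distinct minimizers are the two positive roots of the fourth-order polynomial equation $$\frac{p^4}{2}+(\mu\widetilde\omega_2-\widetilde\omega_1)(\widetilde\omega_2-\mu\widetilde\omega_1)\,p^2+2\mu^2\widetilde\omega_1^2\widetilde\omega_2^2=0.$$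
   Context: Here $\mu=\sqrt{\nu_1/\nu_2}$ is the square root of the ratio of two diffusion coefficients $\nu_1,\nu_2>0$, and $[\widetilde\omega_1,\widetilde\omega_2]$ with $0<\widetilde\omega_1<\widetilde\omega_2$ is the frequency range. For $\widetilde\omega>0$ and $p>0$, the convergence factor is $$\rho(\widetilde\omega,p)=\sqrt{\frac{(p-\widetilde\omega)^2+\widetilde\omega^2}{(p+\mu\widetilde\omega)^2+\mu^2\widetilde\omega^2}\cdot\frac{(p-\mu\widetilde\omega)^2+\mu^2\widetilde\omega^2}{(p+\widetilde\omega)^2+\widetilde\omega^2}}.$$ Put $\widetilde\omega_c=\frac{p}{\sqrt{2\mu}}$ and $\delta=\sqrt{(\mu^2-4\mu+1)(\mu^2+1)}$. The value $$R_c:=\rho(\widetilde\omega_c,p)=\rho\Big(\frac{p}{\sqrt{2\mu}},p\Big)=\sqrt{\frac{(\sqrt{2\mu}-1)^2+1}{(\sqrt2+\sqrt\mu)^2+\mu}\cdot\frac{(\sqrt2-\sqrt\mu)^2+\mu}{(\sqrt{2\mu}+1)^2+1}}$$ does not depend on $p$. Further, $$h_1(\mu):=\frac{\mu^2+1+\sqrt{(\mu^2-4\mu+1)(\mu^2+4\mu+1)}}{4\mu},\qquad h_2(\mu):=\frac{(\mu-1)^2+\delta}{2\mu},$$ $$I_l:=\big[\widetilde\omega_1\sqrt{(\mu-1)^2-\delta},\ \sqrt{2\mu}\,\widetilde\omega_1\big],\quad I_c:=\big[\sqrt{2\mu}\,\widetilde\omega_1,\ \sqrt{2\mu}\,\widetilde\omega_2\big],\quad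 I_r:=\big[\sqrt{2\mu}\,\widetilde\omega_2,\ \widetilde\omega_2\sqrt{(\mu-1)^2+\delta}\big].$$ *)

(* Defs.v *)
From mathcomp Require Import all_boot all_order all_algebra.
From mathcomp Require Import all_classical all_reals all_analysis.
From mathcomp Require Import ring lra.
Import Order.TTheory GRing.Theory Num.Theory.
Import numFieldNormedType.Exports.

Set Implicit Arguments.
Unset Strict Implicit.
Unset Printing Implicit Defensive.

Local Open Scope classical_set_scope.
Local Open Scope ring_scope.

Definition rho (R : realType) (mu w p : R) : R :=
  Num.sqrt
    ((((p - w) ^+ 2 + w ^+ 2) / ((p + mu * w) ^+ 2 + mu ^+ 2 * w ^+ 2)) *
     (((p - mu * w) ^+ 2 + mu ^+ 2 * w ^+ 2) / ((p + w) ^+ 2 + w ^+ 2))).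

(* For mu, p, w1 > 0 and w1 <= w2 the supremum is a maximum: see [max_rhoP]. *)
Definition max_rho (R : realType) (mu w1 w2 p : R) : R :=
  sup [set rho mu w p | w in `[w1, w2]].

Definition minimizes (R : realType) (mu w1 w2 p : R) : Prop :=
  0 < p /\ forall q, 0 < q -> max_rho mu w1 w2 p <= max_rho mu w1 w2 q.

Definition delta (R : realType) (mu : R) : R :=
  Num.sqrt ((mu ^+ 2 - 4 * mu + 1) * (mu ^+ 2 + 1)).

(* The common value of rho mu (p / sqrt (2 mu)) p over all p > 0: see [RcE]. *)
Definition Rc (R : realType) (mu : R) : R :=
  Num.sqrt
    ((((Num.sqrt (2 * mu) - 1) ^+ 2 + 1) /
        ((Num.sqrt 2 + Num.sqrt mu) ^+ 2 + mu)) *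
     (((Num.sqrt 2 - Num.sqrt mu) ^+ 2 + mu) /
        ((Num.sqrt (2 * mu) + 1) ^+ 2 + 1))).

Definition h1 (R : realType) (mu : R) : R :=
  (mu ^+ 2 + 1 +
     Num.sqrt ((mu ^+ 2 - 4 * mu + 1) * (mu ^+ 2 + 4 * mu + 1))) / (4 * mu).

Definition h2 (R : realType) (mu : R) : R := ((mu - 1) ^+ 2 + delta mu) / (2 * mu).

Definition Il (R : realType) (mu w1 : R) : interval R :=
  `[w1 * Num.sqrt ((mu - 1) ^+ 2 - delta mu), Num.sqrt (2 * mu) * w1].

Definition Ic (R : realType) (mu w1 w2 : R) : interval R :=
  `[Num.sqrt (2 * mu) * w1, Num.sqrt (2 * mu) * w2].

Definition Ir (R : realType) (mu w2 : R) : interval R :=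
  `[Num.sqrt (2 * mu) * w2, w2 * Num.sqrt ((mu - 1) ^+ 2 + delta mu)].

Definition quartic (R : realType) (mu w1 w2 p : R) : R :=
  p ^+ 4 / 2 + (mu * w2 - w1) * (w2 - mu * w1) * p ^+ 2
  + 2 * mu ^+ 2 * w1 ^+ 2 * w2 ^+ 2.

Lemma RcE (R : realType) (mu p : R) : 0 < mu -> 0 < p -> rho mu (p / Num.sqrt (2 * mu)) p = Rc mu.
Proof.
move=> mu0 p0; rewrite /rho /Rc; congr Num.sqrt.
rewrite sqrtrM; last lra.
have a2 : Num.sqrt 2 ^+ 2 = 2 :> R by rewrite sqr_sqrtr.
have b2 : Num.sqrt mu ^+ 2 = mu by rewrite sqr_sqrtr // ltW.
have a0 : 0 < Num.sqrt 2 :> R by rewrite sqrtr_gt0.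
have b0 : 0 < Num.sqrt mu by rewrite sqrtr_gt0.
move: (Num.sqrt 2) (Num.sqrt mu) a2 b2 a0 b0 => a b a2 b2 a0 b0.
rewrite -b2 {mu mu0 b2}.
have ab0 : 0 < a * b by exact: mulr_gt0.
have D1 : (a * b + 1) ^+ 2 + 1 != 0 by rewrite gt_eqF// addr_gt0// exprn_gt0//; lra.
have D2 : (a + b) ^+ 2 + b ^+ 2 != 0
  by rewrite gt_eqF// addr_gt0// exprn_gt0//; lra.
have D0 : a != 0 by rewrite gt_eqF.
have D0' : b != 0 by rewrite gt_eqF.
have Dp : p != 0 by rewrite gt_eqF.
set w := p / (a * b).
have w0 : w != 0 by rewrite mulf_neq0 ?invr_neq0 ?mulf_neq0.
have -> : p = w * (a * b) by rewrite /w; field; rewrite D0 D0'.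
have e1 : (w * (a * b) - w) ^+ 2 + w ^+ 2 = w ^+ 2 * ((a * b - 1) ^+ 2 + 1) by ring.
have e2 : (w * (a * b) + w) ^+ 2 + w ^+ 2 = w ^+ 2 * ((a * b + 1) ^+ 2 + 1) by ring.
have e3 : (w * (a * b) + b ^+ 2 * w) ^+ 2 + b ^+ 2 ^+ 2 * w ^+ 2 =
   w ^+ 2 * b ^+ 2 * ((a + b) ^+ 2 + b ^+ 2) by ring.
have e4 : (w * (a * b) - b ^+ 2 * w) ^+ 2 + b ^+ 2 ^+ 2 * w ^+ 2 =
   w ^+ 2 * b ^+ 2 * ((a - b) ^+ 2 + b ^+ 2) by ring.
rewrite e1 e2 e3 e4; move: D1 D2 w0 D0'.
move: (_ + 1) (_ + 1) (_ + b ^+ 2) (_ + b ^+ 2) => x y z t D1 D2 w0 D0'.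
by field; rewrite ?D1 ?D2 ?w0 ?D0'.
Qed.

Lemma max_rhoP (R : realType) (mu w1 w2 p : R) : 0 < mu -> 0 < p -> 0 < w1 -> w1 <= w2 ->
  (exists2 w, w \in `[w1, w2] & rho mu w p = max_rho mu w1 w2 p) /\
  (forall w, w \in `[w1, w2] -> rho mu w p <= max_rho mu w1 w2 p).
Proof.
move=> mu0 p0 w10 w12.
have cont : {within `[w1, w2], continuous (fun w => rho mu w p)}.
  apply: continuous_in_subspaceT => w; rewrite inE /= in_itv /= => /andP[w1w _].
  have w0 : 0 < w by exact: lt_le_trans w1w.
  pose g x := (((p - x) ^+ 2 + x ^+ 2) / ((p + mu * x) ^+ 2 + mu ^+ 2 * x ^+ 2)) *
    (((p - mu * x) ^+ 2 + mu ^+ 2 * x ^+ 2) / ((p + x) ^+ 2 + x ^+ 2)).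
  suff cg : {for w, continuous g}.
    by apply: (@continuous_comp _ _ _ g (@Num.sqrt R)) => //; exact: sqrt_continuous.
  have cM c : {for w, continuous (fun x : R => c * x)}.
    by apply: continuousM; [exact: cvg_cst | exact: cvg_id].
  have cX : {for w, continuous (fun x : R => x ^+ 2)} by exact: exprn_continuous.
  have cS (f : R -> R) : {for w, continuous f} -> {for w, continuous (fun x => f x ^+ 2)}.
    move=> cf; apply: (@continuous_comp _ _ _ f (fun x : R => x ^+ 2)) => //.
    exact: exprn_continuous.
  have cA c (f : R -> R) : {for w, continuous f} -> {for w, continuous (fun x => c + f x)}.
    by move=> cf; apply: continuousD => //; exact: cvg_cst.
  have cB c (f : R -> R) : {for w, continuous f} -> {for w, continuous (fun x => c - f x)}.
    by move=> cf; apply: continuousB => //; exact: cvg_cst.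
  have cI : {for w, continuous (fun x : R => x)} by exact: cvg_id.
  have cC : {for w, continuous (fun x : R => mu ^+ 2 * x ^+ 2)}.
    by apply: continuousM => //; exact: cvg_cst.
  have muw : 0 < mu * w by exact: mulr_gt0.
  apply: continuousM; apply: continuousM.
  - by apply: continuousD => //; apply: cS; exact: cB.
  - apply: continuousV.
      apply/lt0r_neq0/ltr_wpDr; first by rewrite mulr_ge0 ?sqr_ge0.
      by apply: exprn_gt0; exact: addr_gt0.
    by apply: continuousD => //; apply: cS; exact: cA.
  - by apply: continuousD => //; apply: cS; exact: cB.
  - apply: continuousV.
      apply/lt0r_neq0/ltr_wpDr; first exact: sqr_ge0.
      by apply: exprn_gt0; exact: addr_gt0.
    by apply: continuousD => //; apply: cS; exact: cA.
have [c cin cmax] := EVT_max w12 cont.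
have -> : max_rho mu w1 w2 p = rho mu c p.
  apply/eqP; rewrite eq_le; apply/andP; split.
    apply: ge_sup; first by exists (rho mu c p), c.
    by move=> _ [w win <-]; exact: cmax.
  apply: ub_le_sup; last by exists c.
  by exists (rho mu c p) => _ [w win <-]; exact: cmax.
by split => //; exists c.
Qed.

(* Main.v *)
Require Import Defs.
From mathcomp Require Import all_boot all_order all_algebra.
From mathcomp Require Import all_classical all_reals all_analysis.
From mathcomp Require Import ring lra.
Import Order.TTheory GRing.Theory Num.Theory.
Local Open Scope ring_scope.
Set Implicit Arguments.
Unset Strict Implicit.

(** Everything goes through one variable. With T = p / w + 2 mu w / p, the
    square of the convergence factor is g(T), where
    g(T) = (T^2 - 2 (mu + 1) T + C) / (T^2 + 2 (mu + 1) T + C) and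
    C = 2 (mu^2 + 1). Two values satisfy g(s) <= g(t) exactly when
    (t - s) (t s - C) >= 0 ([rho_leE]): g decreases up to T = sqrt C and then
    increases, and takes equal values at s and C / s. By the inequality of
    arithmetic and geometric means T >= 2 m with m = sqrt (2 mu), with equality
    when p = m w; the value of the factor there is Rc. The hypothesis
    mu > 2 + sqrt 3 says that 2 m < sqrt C, so that Rc is a local maximum of the
    factor in w, surrounded by two valleys where T = sqrt C.

    Since T is quasiconvex in w and g is decreasing-increasing, the maximum over
    the frequency range is attained at an end of the range, or equals Rc, which
    competes exactly when p = m w for some w in the range, i.e. when p lies in
    Ic. The inversion p |-> 2 mu w1 w2 / p exchanges the values of T at w and
    w1 w2 / w, hence leaves this maximum unchanged ([max_rho_mirror]); its fixed
    point is pstar, so it suffices to study p >= pstar.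

    Beyond pstar, T(w1, p) increases and dominates T(w2, p). While p stays in
    Ic, the maximum is at least Rc. Beyond m w2 it is at least Rc too when
    T(w1, m w2) >= C / (2 m), which says w2 / w1 >= h1. In that case Rc is a
    lower bound, reached at pstar and around it as soon as the factor at
    (w1, pstar) is below Rc ([pstar_nbhs]); w2 / w1 <= h2 is enough for this.
    If instead that factor is at least Rc, it is the maximum at pstar, and going
    away from pstar makes it strictly larger ([max_rho_pstar_lt]).
    If w2 / w1 <= h1, there is pr >= m w2 where the ends of the range lie in
    opposite branches of g at equal height, T(w1, pr) T(w2, pr) = C, a value at
    most Rc. Moving p to the left raises the factor at w2 and moving it to the
    right raises the factor at w1, so pr is optimal ([minimizes_pr]), as is its
    mirror image. Clearing denominators in T(w1, p) T(w2, p) = C gives the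
    quartic equation. *)

(** * The convergence factor as a function of one variable *)

Section Factor.
Variables (R : realType) (mu : R).
Implicit Types w p v q : R.
Hypothesis hmu : 2 + Num.sqrt 3 < mu.

Definition spread (w p : R) : R := p / w + 2 * mu * w / p.
(** The square of the value of [spread] at which the factor is smallest. *)
Definition turn_sqr : R := 2 * (mu ^+ 2 + 1).
Notation m := (Num.sqrt (2 * mu)).

Lemma mu_gt2 : 2 < mu.
Proof. by apply: le_lt_trans hmu; rewrite lerDl sqrtr_ge0. Qed.

Lemma mu_gt0 : 0 < mu.
Proof. by have := mu_gt2; lra. Qed.

(** The roots of this polynomial are [2 - sqrt 3] and [2 + sqrt 3]. *)
Lemma mu_poly_gt0 : 0 < mu ^+ 2 - 4 * mu + 1.
Proof.
have s0 := sqrtr_ge0 (3 : R); have s2 : Num.sqrt (3 : R) ^+ 2 = 3 by rewrite sqr_sqrtr.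
move: hmu s0 s2; move: (Num.sqrt 3) => s h s0 s2.
have : 0 < (mu - 2 - s) * (mu - 2 + s) by rewrite mulr_gt0//; lra.
by rewrite -subr_sqr s2; lra.
Qed.

(** The least spread, [2 m], lies strictly left of the turning point
    [sqrt turn_sqr]: this is what makes [Rc] a local maximum over frequencies. *)
Lemma turn_sqr_gt : 8 * mu < turn_sqr.
Proof. by have := mu_poly_gt0; rewrite /turn_sqr; lra. Qed.

Lemma m_gt0 : 0 < m.
Proof. by rewrite sqrtr_gt0; have := mu_gt0; lra. Qed.

Lemma m_sqr : m ^+ 2 = 2 * mu.
Proof. by rewrite sqr_sqrtr//; have := mu_gt0; lra. Qed.

Lemma spread_gt0 w p : 0 < w -> 0 < p -> 0 < spread w p.
Proof.
move=> w0 p0; have := mu_gt0 => mu0.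
by rewrite addr_gt0 ?divr_gt0// !mulr_gt0.
Qed.

(** Numerator and denominator of [rho ^+ 2] are quartics in [x = p / w] that
    are self-reciprocal for [x |-> 2 * mu / x]; dividing them by [x ^+ 2] leaves
    polynomials in [spread]. *)
Lemma rhoE w p : 0 < w -> 0 < p ->
  rho mu w p =
  Num.sqrt ((spread w p ^+ 2 - 2 * (mu + 1) * spread w p + turn_sqr) /
            (spread w p ^+ 2 + 2 * (mu + 1) * spread w p + turn_sqr)).
Proof.
move=> w0 p0; have mu0 := mu_gt0; rewrite /rho; congr Num.sqrt.
have muw0 : 0 < mu * w by exact: mulr_gt0.
have T0 := spread_gt0 w0 p0.
have d1 : 0 < (p + mu * w) ^+ 2 + mu ^+ 2 * w ^+ 2 by nra.
have d2 : 0 < (p + w) ^+ 2 + w ^+ 2 by nra.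
have d3 : spread w p ^+ 2 + 2 * (mu + 1) * spread w p + turn_sqr =
  ((p + mu * w) ^+ 2 + mu ^+ 2 * w ^+ 2) * ((p + w) ^+ 2 + w ^+ 2) / (p * w) ^+ 2.
  by rewrite /spread /turn_sqr; field; rewrite !gt_eqF.
have d4 : spread w p ^+ 2 - 2 * (mu + 1) * spread w p + turn_sqr =
  ((p - mu * w) ^+ 2 + mu ^+ 2 * w ^+ 2) * ((p - w) ^+ 2 + w ^+ 2) / (p * w) ^+ 2.
  by rewrite /spread /turn_sqr; field; rewrite !gt_eqF.
rewrite d3 d4; move: d1 d2.
set a := _ + _ * _; set b := _ + w ^+ 2; set c := _ + _ * _ => d1 d2.
by field; rewrite !gt_eqF.
Qed.

(** Cross-multiplying the two quotients of [rhoE], the difference factors as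
    [4 * (mu + 1)] times the right-hand side. Both the monotonicity on each side
    of the turning point and the pairing [s <-> turn_sqr / s] of equal values
    can be read off. *)
Lemma rho_leE w p v q : 0 < w -> 0 < p -> 0 < v -> 0 < q ->
  (rho mu w p <= rho mu v q) =
  (0 <= (spread v q - spread w p) * (spread v q * spread w p - turn_sqr)).
Proof.
move=> w0 p0 v0 q0; rewrite !rhoE//.
have mu0 := mu_gt0; have c0 := turn_sqr_gt.
have := spread_gt0 w0 p0; have := spread_gt0 v0 q0.
move: (spread w p) (spread v q) => s t t0 s0.
have den x : 0 < x -> 0 < x ^+ 2 + 2 * (mu + 1) * x + turn_sqr by move=> x0; nra.
rewrite ler_sqrt; last first.
  rewrite divr_ge0 ?(ltW (den _ _))//.
  have -> : t ^+ 2 - 2 * (mu + 1) * t + turn_sqr = (t - (mu + 1)) ^+ 2 + (mu - 1) ^+ 2.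
    by rewrite /turn_sqr; ring.
  by rewrite addr_ge0 ?sqr_ge0.
rewrite ler_pdivrMr ?den// [leRHS]mulrAC ler_pdivlMr ?den// -subr_ge0.
have -> : (t ^+ 2 - 2 * (mu + 1) * t + turn_sqr) * (s ^+ 2 + 2 * (mu + 1) * s + turn_sqr) -
          (s ^+ 2 - 2 * (mu + 1) * s + turn_sqr) * (t ^+ 2 + 2 * (mu + 1) * t + turn_sqr) =
          4 * (mu + 1) * ((t - s) * (t * s - turn_sqr)) by ring.
by rewrite pmulr_rge0// mulr_gt0//; lra.
Qed.

Lemma rho_le_right w p v q : 0 < w -> 0 < p -> 0 < v -> 0 < q ->
  spread w p <= spread v q -> turn_sqr <= spread v q * spread w p ->
  rho mu w p <= rho mu v q.
Proof. by move=> *; rewrite rho_leE// mulr_ge0// subr_ge0. Qed.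

Lemma rho_le_left w p v q : 0 < w -> 0 < p -> 0 < v -> 0 < q ->
  spread v q <= spread w p -> spread v q * spread w p <= turn_sqr ->
  rho mu w p <= rho mu v q.
Proof. by move=> *; rewrite rho_leE// mulr_le0// subr_le0. Qed.

Lemma rho_lt_right w p v q : 0 < w -> 0 < p -> 0 < v -> 0 < q ->
  spread w p < spread v q -> turn_sqr < spread v q * spread w p ->
  rho mu w p < rho mu v q.
Proof.
move=> w0 p0 v0 q0 h k; rewrite ltNge rho_leE// -ltNge nmulr_rlt0 ?subr_lt0//.
by rewrite subr_gt0 mulrC.
Qed.

Lemma rho_lt_left w p v q : 0 < w -> 0 < p -> 0 < v -> 0 < q ->
  spread v q < spread w p -> spread v q * spread w p < turn_sqr ->
  rho mu w p < rho mu v q.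
Proof.
move=> w0 p0 v0 q0 h k; rewrite ltNge rho_leE// -ltNge pmulr_rlt0 ?subr_gt0//.
by rewrite subr_lt0 mulrC.
Qed.

Lemma rho_eqP w p v q : 0 < w -> 0 < p -> 0 < v -> 0 < q ->
  rho mu w p = rho mu v q <->
  spread w p = spread v q \/ spread w p * spread v q = turn_sqr.
Proof.
move=> w0 p0 v0 q0.
have -> : rho mu w p = rho mu v q <->
  (spread v q - spread w p) * (spread v q * spread w p - turn_sqr) = 0.
  split=> [e|e].
    apply/eqP; rewrite eq_le.
    have : rho mu v q <= rho mu w p by rewrite e.
    rewrite rho_leE// -oppr_le0 -mulNr opprB (mulrC (spread v q)) => ->.
    by rewrite (mulrC (spread w p)) -rho_leE// e /=.
  apply/eqP; rewrite eq_le rho_leE// e lexx /=.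
  by rewrite rho_leE// -oppr_le0 -mulNr opprB (mulrC (spread w p)) e.
split=> [/eqP|[->|]].
- rewrite mulf_eq0 !subr_eq0 => /orP[/eqP->|/eqP e]; first by left.
  by right; rewrite mulrC.
- by rewrite subrr mul0r.
- by rewrite mulrC => ->; rewrite subrr mulr0.
Qed.

Lemma rho_spread w p v q : 0 < w -> 0 < p -> 0 < v -> 0 < q ->
  spread w p = spread v q -> rho mu w p = rho mu v q.
Proof. by move=> *; apply/rho_eqP => //; left. Qed.

Lemma spread_le_p w p q : 0 < w -> 0 < p -> 0 < q ->
  (spread w p <= spread w q) = (0 <= (q - p) * (p * q - 2 * mu * w ^+ 2)).
Proof.
move=> w0 p0 q0; rewrite -subr_ge0.
have -> : spread w q - spread w p =
   (w * p * q)^-1 * ((q - p) * (p * q - 2 * mu * w ^+ 2)).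
  by rewrite /spread; field; rewrite !gt_eqF.
by rewrite pmulr_rge0// invr_gt0 !mulr_gt0.
Qed.

Lemma spread_le_w w v p : 0 < w -> 0 < v -> 0 < p ->
  (spread w p <= spread v p) = (0 <= (v - w) * (2 * mu * (w * v) - p ^+ 2)).
Proof.
move=> w0 v0 p0; rewrite -subr_ge0.
have -> : spread v p - spread w p =
   (w * v * p)^-1 * ((v - w) * (2 * mu * (w * v) - p ^+ 2)).
  by rewrite /spread; field; rewrite !gt_eqF.
by rewrite pmulr_rge0// invr_gt0 !mulr_gt0.
Qed.

Lemma spread_lt_p w p q : 0 < w -> 0 < p -> p < q -> 2 * mu * w ^+ 2 < p * q ->
  spread w p < spread w q.
Proof.
move=> w0 p0 pq h; have q0 := lt_trans p0 pq.
by rewrite ltNge spread_le_p// -ltNge nmulr_rlt0 ?subr_lt0// subr_gt0 (mulrC q).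
Qed.

Lemma spread_m w : 0 < w -> spread w (m * w) = 2 * m.
Proof.
move=> w0; move: m m_gt0 m_sqr => k k0 k2; rewrite /spread -k2; field.
by rewrite !gt_eqF.
Qed.

Lemma spread_ge w p : 0 < w -> 0 < p -> 2 * m <= spread w p.
Proof.
move=> w0 p0; rewrite -(spread_m w0) spread_le_p ?mulr_gt0 ?m_gt0//.
move: m m_gt0 m_sqr => k k0 k2; rewrite -k2.
have -> : (p - k * w) * (k * w * p - k ^+ 2 * w ^+ 2) = (k * w) * (p - k * w) ^+ 2.
  by ring.
by rewrite mulr_ge0 ?sqr_ge0// ltW// mulr_gt0.
Qed.

(** [spread] is least at [p = m * w], the frequency at which [Rc] is the value. *)
Lemma rho_m w : 0 < w -> rho mu w (m * w) = Rc mu.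
Proof.
move=> w0; have m0 := m_gt0; rewrite -(@RcE _ mu (m * w)) ?mulr_gt0 ?mu_gt0//.
by rewrite [m * w / m]mulrAC divff ?mul1r// gt_eqF.
Qed.

Lemma rho_le_Rc w p : 0 < w -> 0 < p -> 2 * m * spread w p <= turn_sqr ->
  rho mu w p <= Rc mu.
Proof.
move=> w0 p0 h; rewrite -(rho_m w0) rho_le_left ?mulr_gt0 ?m_gt0// spread_m//.
exact: spread_ge.
Qed.

Lemma rho_ge_Rc w p : 0 < w -> 0 < p -> turn_sqr <= 2 * m * spread w p ->
  Rc mu <= rho mu w p.
Proof.
move=> w0 p0 h; rewrite -(rho_m w0) rho_le_right ?mulr_gt0 ?m_gt0 ?spread_m//.
  exact: spread_ge.
by rewrite mulrC.
Qed.

(** The factor decreases and then increases with [spread], so on an interval of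
    spreads it is at most its value at one of the ends. *)
Lemma rho_quasiconvex w p v1 q1 v2 q2 M :
  0 < w -> 0 < p -> 0 < v1 -> 0 < q1 -> 0 < v2 -> 0 < q2 ->
  spread v1 q1 <= spread w p <= spread v2 q2 ->
  rho mu v1 q1 <= M -> rho mu v2 q2 <= M -> rho mu w p <= M.
Proof.
move=> w0 p0 v10 q10 v20 q20 /andP[h1 h2] M1 M2.
have [h|h] := lerP (spread v1 q1 * spread w p) turn_sqr.
  by apply: le_trans M1; exact: rho_le_left.
apply: le_trans M2; apply: rho_le_right => //.
by apply: (le_trans (ltW h)); rewrite ler_wpM2r ?(le_trans h1)// ltW ?spread_gt0.
Qed.

Lemma delta_sqr : delta mu ^+ 2 = ((mu - 1) ^+ 2) ^+ 2 - 4 * mu ^+ 2.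
Proof.
rewrite sqr_sqrtr; first by ring.
by rewrite mulr_ge0 ?(ltW mu_poly_gt0)// addr_ge0 ?sqr_ge0.
Qed.

Lemma delta_lt : delta mu < (mu - 1) ^+ 2.
Proof.
rewrite -(ltr_pXn2r (n := 2))// ?nnegrE ?sqr_ge0 ?sqrtr_ge0//.
by rewrite delta_sqr gtrDl oppr_lt0 mulr_gt0// exprn_gt0// mu_gt0.
Qed.

(** With [X = (p / w) ^+ 2] the hypothesis reads
    [X ^+ 2 - 2 * (mu - 1) ^+ 2 * X + 4 * mu ^+ 2 <= 0], and the roots of this
    quadratic polynomial are [(mu - 1) ^+ 2 - delta] and [(mu - 1) ^+ 2 + delta].
    This is where the outer ends of [Il] and [Ir] come from. *)
Lemma spread_sqr_le w p : 0 < w -> 0 < p -> spread w p ^+ 2 <= turn_sqr ->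
  ((mu - 1) ^+ 2 - delta mu) * w ^+ 2 <= p ^+ 2 <=
  ((mu - 1) ^+ 2 + delta mu) * w ^+ 2.
Proof.
move=> w0 p0.
have -> : spread w p ^+ 2 = (p ^+ 2 + 2 * mu * w ^+ 2) ^+ 2 / (w ^+ 2 * p ^+ 2).
  by rewrite /spread; field; rewrite !gt_eqF.
have W0 : 0 < w ^+ 2 by rewrite exprn_gt0.
have P0 : 0 < p ^+ 2 by rewrite exprn_gt0.
rewrite ler_pdivrMr ?mulr_gt0// /turn_sqr.
have d0 : 0 <= delta mu := sqrtr_ge0 _.
move: (w ^+ 2) (p ^+ 2) W0 P0 (delta mu) d0 delta_sqr => W P W0 P0 d d0 d2 h.
have {}h : (P - (mu - 1) ^+ 2 * W) ^+ 2 <= (d * W) ^+ 2.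
  rewrite [leRHS]exprMn d2; lra.
have dW : 0 <= d * W by rewrite mulr_ge0// ltW.
have : `|P - (mu - 1) ^+ 2 * W| <= d * W.
  by rewrite -[leRHS](ger0_norm dW) -ler_sqr ?nnegrE// !real_normK ?num_real.
by rewrite ler_norml => /andP[lo hi]; apply/andP; split; lra.
Qed.

End Factor.

(** * The thresholds on the ratio of the frequencies *)

(** For [k = w2 / w1] the left-hand side is [w1 ^+ 2 * (a * k ^+ 2 - c * k + a)].
    Its two roots in [k] are inverse to each other and [k > 1], so only the
    larger one matters: the factor of the smaller root is absorbed in [K]. *)
Lemma quadratic_ratio (R : realType) (a c w1 w2 : R) :
  0 < a -> 2 * a <= c -> 0 < w1 -> w1 < w2 ->
  exists2 K, 0 < K & a * (w1 ^+ 2 + w2 ^+ 2) - c * (w1 * w2) =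
    K * (w2 / w1 - (c + Num.sqrt (c ^+ 2 - 4 * a ^+ 2)) / (2 * a)).
Proof.
move=> a0 ac w10 w12.
have d0 : 0 <= c ^+ 2 - 4 * a ^+ 2 by nra.
have s0 := sqrtr_ge0 (c ^+ 2 - 4 * a ^+ 2); have s2 := sqr_sqrtr d0.
move: (Num.sqrt _) s0 s2 => s s0 s2.
exists (w1 * (2 * a * w2 - (c - s) * w1) / 2).
  have cs : c - 2 * a <= s.
    by rewrite -(ler_pXn2r (n := 2))// ?nnegrE ?subr_ge0// s2; nra.
  rewrite divr_gt0// mulr_gt0// subr_gt0.
  apply: (@le_lt_trans _ _ (2 * a * w1)); last by rewrite ltr_pM2l// mulr_gt0.
  by rewrite ler_pM2r//; lra.
have -> : w1 * (2 * a * w2 - (c - s) * w1) / 2 * (w2 / w1 - (c + s) / (2 * a)) =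
    a * w2 ^+ 2 - c * (w1 * w2) + (c ^+ 2 - s ^+ 2) * w1 ^+ 2 / (4 * a).
  by field; rewrite !gt_eqF.
by rewrite s2; field; rewrite gt_eqF.
Qed.

Section Range.
Variables (R : realType) (mu w1 w2 : R).
Implicit Types w p q : R.
Hypothesis hmu : 2 + Num.sqrt 3 < mu.
Hypotheses (hw1 : 0 < w1) (hw12 : w1 < w2).
Notation m := (Num.sqrt (2 * mu)).
Notation spread := (spread mu).
Notation turn_sqr := (turn_sqr mu).

Let mu0 := mu_gt0 hmu.
Let m0 := m_gt0 hmu.
Let w20 : 0 < w2 := lt_trans hw1 hw12.

(** Here [c ^+ 2 - 4 * a ^+ 2] with [a = 2 * mu] and [c = mu ^+ 2 + 1] is the
    radicand of [h1]. *)
Lemma h1_sign : exists2 K, 0 < K &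
  2 * mu * (w1 ^+ 2 + w2 ^+ 2) - (mu ^+ 2 + 1) * (w1 * w2) =
  K * (w2 / w1 - h1 mu).
Proof.
have q := mu_poly_gt0 hmu.
have mu20 : 0 < 2 * mu by exact: mulr_gt0.
have [|K K0 ->] := quadratic_ratio (c := mu ^+ 2 + 1) mu20 _ hw1 hw12; first lra.
exists K => //; rewrite /h1; congr (_ * (_ - (_ + Num.sqrt _) / _)); ring.
Qed.

(** Likewise with [a = mu] and [c = (mu - 1) ^+ 2], where
    [c - 2 * a = mu ^+ 2 - 4 * mu + 1] and [c + 2 * a = mu ^+ 2 + 1]. *)
Lemma h2_sign : exists2 K, 0 < K &
  mu * (w1 ^+ 2 + w2 ^+ 2) - (mu - 1) ^+ 2 * (w1 * w2) =
  K * (w2 / w1 - h2 mu).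
Proof.
have q := mu_poly_gt0 hmu.
have [|K K0 ->] := quadratic_ratio (c := (mu - 1) ^+ 2) mu0 _ hw1 hw12; first lra.
exists K => //; rewrite /h2 /delta; congr (_ * (_ - (_ + Num.sqrt _) / _)); ring.
Qed.

(** * The worst frequency in the range *)

Lemma rho_le_max w p : 0 < p -> w1 <= w <= w2 -> rho mu w p <= max_rho mu w1 w2 p.
Proof.
by move=> p0 hw; apply: (max_rhoP mu0 p0 hw1 (ltW hw12)).2; rewrite in_itv.
Qed.

Lemma rho_le_maxl p : 0 < p -> rho mu w1 p <= max_rho mu w1 w2 p.
Proof. by move=> p0; rewrite rho_le_max// lexx ltW. Qed.

Lemma rho_le_maxr p : 0 < p -> rho mu w2 p <= max_rho mu w1 w2 p.
Proof. by move=> p0; rewrite rho_le_max// lexx ltW. Qed.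

Lemma max_rho_le p M : 0 < p -> (forall w, w1 <= w <= w2 -> rho mu w p <= M) ->
  max_rho mu w1 w2 p <= M.
Proof.
move=> p0 h; have [[w win <-] _] := max_rhoP mu0 p0 hw1 (ltW hw12).
by apply: h; move: win; rewrite in_itv.
Qed.

(** At fixed [p], [spread] is a convex function of the frequency. *)
Lemma spread_le_max_ends w p : 0 < p -> w1 <= w <= w2 ->
  spread w p <= Num.max (spread w1 p) (spread w2 p).
Proof.
move=> p0 /andP[a b]; have w0 : 0 < w by exact: lt_le_trans a.
rewrite le_max !spread_le_w//.
have [h|h] := leP (2 * mu * (w * w1) - p ^+ 2) 0.
  by rewrite mulr_le0// subr_le0.
apply/orP; right; apply: mulr_ge0; first by rewrite subr_ge0.
apply: (le_trans (ltW h)).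
by rewrite lerD2r ler_wpM2l ?mulr_ge0// ?(ltW mu0)// ler_wpM2l ?ltW.
Qed.

(** The spreads met in the range lie between [2 * m], where the factor is [Rc],
    and one of the end values. *)
Lemma max_rho_le_Rc p M : 0 < p -> Rc mu <= M ->
  rho mu w1 p <= M -> rho mu w2 p <= M -> max_rho mu w1 w2 p <= M.
Proof.
move=> p0 hR h1 h2; apply: max_rho_le => // w hw.
have w0 : 0 < w by case/andP: hw => a _; exact: lt_le_trans a.
have hm : 2 * m <= spread w p by exact: spread_ge.
have := spread_le_max_ends p0 hw; rewrite le_max => /orP[] h.
  apply: (@rho_quasiconvex _ _ hmu w p w1 (m * w1) w1 p) => //.
  - exact: mulr_gt0.
  - by rewrite spread_m// hm.
  - by rewrite rho_m.
apply: (@rho_quasiconvex _ _ hmu w p w1 (m * w1) w2 p) => //.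
- exact: mulr_gt0.
- by rewrite spread_m// hm.
- by rewrite rho_m.
Qed.

(** To the right of [Ic], [spread] is monotone in the frequency, so that [Rc]
    does not enter the maximum. *)
Lemma max_rho_le_ends p M : m * w2 <= p ->
  rho mu w1 p <= M -> rho mu w2 p <= M -> max_rho mu w1 w2 p <= M.
Proof.
move=> hp h1 h2; have p0 : 0 < p by apply: lt_le_trans hp; exact: mulr_gt0.
apply: max_rho_le => // w /andP[a b].
have w0 : 0 < w by exact: lt_le_trans a.
have hp2 : 2 * mu * w2 ^+ 2 <= p ^+ 2.
  by rewrite -[in leLHS](m_sqr hmu) -exprMn lerXn2r// nnegrE ltW// mulr_gt0.
have hv v : 0 < v -> v <= w2 -> 2 * mu * (v * w2) <= p ^+ 2.
  move=> v0 hv; apply: le_trans hp2; rewrite ler_wpM2l ?mulr_ge0 ?(ltW mu0)//.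
  by rewrite expr2 ler_wpM2r// ltW.
apply: (@rho_quasiconvex _ _ hmu w p w2 p w1 p) => //.
rewrite !spread_le_w//; apply/andP; split.
  by rewrite mulr_le0 ?subr_le0// (mulrC w2) hv.
rewrite mulr_le0 ?subr_le0// (le_trans _ (hv _ w0 b))//.
by rewrite ler_wpM2l ?mulr_ge0 ?(ltW mu0)// ler_wpM2l ?ltW// ltW.
Qed.

(** The range contains the frequency [p / m], where the factor is [Rc]. *)
Lemma max_rho_ge_Rc p : m * w1 <= p <= m * w2 -> Rc mu <= max_rho mu w1 w2 p.
Proof.
move=> /andP[a b]; have p0 : 0 < p by apply: lt_le_trans a; exact: mulr_gt0.
rewrite -(RcE mu0 p0) rho_le_max// ler_pdivlMr// ler_pdivrMr//.
by rewrite mulrC a mulrC.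
Qed.

(** * Inversion about the balanced parameter *)

Definition mirror (p : R) : R := 2 * mu * w1 * w2 / p.

Lemma mirror_gt0 p : 0 < p -> 0 < mirror p.
Proof. by move=> p0; rewrite divr_gt0// !mulr_gt0. Qed.

Lemma mirrorK p : 0 < p -> mirror (mirror p) = p.
Proof. by move=> p0; rewrite /mirror; field; rewrite !gt_eqF. Qed.

(** Inverting the parameter amounts to the inversion [w |-> w1 * w2 / w] of the
    frequency, which permutes the range. *)
Lemma spread_mirror w p : 0 < w -> 0 < p -> spread w (mirror p) = spread (w1 * w2 / w) p.
Proof. by move=> w0 p0; rewrite /spread /mirror; field; rewrite !gt_eqF. Qed.

Lemma spread_mirror2 p : 0 < p -> spread w2 (mirror p) = spread w1 p.
Proof. by move=> p0; rewrite spread_mirror// mulfK ?gt_eqF. Qed.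

Lemma spread_mirror1 p : 0 < p -> spread w1 (mirror p) = spread w2 p.
Proof. by move=> p0; rewrite spread_mirror// (mulrC w1) mulfK ?gt_eqF. Qed.

Lemma max_rho_mirror p : 0 < p -> max_rho mu w1 w2 (mirror p) = max_rho mu w1 w2 p.
Proof.
have half q : 0 < q -> max_rho mu w1 w2 (mirror q) <= max_rho mu w1 w2 q.
  move=> q0; apply: max_rho_le => [|w /andP[a b]]; first exact: mirror_gt0.
  have w0 : 0 < w by exact: lt_le_trans a.
  have -> : rho mu w (mirror q) = rho mu (w1 * w2 / w) q.
    by apply: rho_spread; rewrite ?spread_mirror ?mirror_gt0 ?divr_gt0 ?mulr_gt0.
  apply: rho_le_max => //; rewrite ler_pdivlMr// ler_pdivrMr//.
  by rewrite ler_wpM2l ?(ltW hw1)// mulrC ler_wpM2l// ltW.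
move=> p0; apply/eqP; rewrite eq_le half//=.
by rewrite -{1}(mirrorK p0) half// mirror_gt0.
Qed.

Lemma minimizes_mirror p : 0 < p -> minimizes mu w1 w2 p -> minimizes mu w1 w2 (mirror p).
Proof.
by move=> p0 [_ h]; split; [exact: mirror_gt0|move=> q q0; rewrite max_rho_mirror// h].
Qed.

Definition pstar : R := Num.sqrt (2 * mu * w1 * w2).

Lemma pstar_gt0 : 0 < pstar.
Proof. by rewrite sqrtr_gt0 !mulr_gt0. Qed.

Lemma pstar_sqr : pstar ^+ 2 = 2 * mu * w1 * w2.
Proof. by rewrite sqr_sqrtr// ltW// !mulr_gt0. Qed.

Lemma mirror_pstar : mirror pstar = pstar.
Proof. by rewrite /mirror -pstar_sqr expr2 mulfK// gt_eqF ?pstar_gt0. Qed.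

Lemma mirror_lt p q : 0 < p -> p < q -> mirror q < mirror p.
Proof.
move=> p0 pq; rewrite /mirror ltr_pM2l ?mulr_gt0//.
by rewrite ltf_pV2// posrE// (lt_trans p0 pq).
Qed.

Lemma mirror_lt_pstar p : pstar < p -> mirror p < pstar.
Proof. by move=> h; rewrite -[ltRHS]mirror_pstar mirror_lt// pstar_gt0. Qed.

Lemma ge_mirror p : 0 < p -> p <= pstar -> pstar <= mirror p.
Proof.
move=> p0; rewrite le_eqVlt => /predU1P[->|h]; first by rewrite mirror_pstar.
by rewrite -{1}mirror_pstar ltW// mirror_lt.
Qed.

Lemma m_lt_pstar : m * w1 < pstar.
Proof.
rewrite -(ltr_pXn2r (n := 2))// ?nnegrE ?(ltW pstar_gt0) ?mulr_ge0 ?(ltW m0) ?(ltW hw1)//.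
by rewrite pstar_sqr exprMn (m_sqr hmu) expr2 mulrA ltr_pM2l ?mulr_gt0.
Qed.

Lemma pstar_lt_m : pstar < m * w2.
Proof.
rewrite -(ltr_pXn2r (n := 2))// ?nnegrE ?(ltW pstar_gt0) ?mulr_ge0 ?(ltW m0) ?(ltW w20)//.
by rewrite pstar_sqr exprMn (m_sqr hmu) expr2 mulrA ltr_pM2r// ltr_pM2l ?mulr_gt0.
Qed.

Notation ps := pstar.
Let ps0 : 0 < ps := pstar_gt0.

(** * Comparison with the interior maximum *)

Lemma spread1_mw2 : 2 * m * spread w1 (m * w2) = 4 * mu * (w1 ^+ 2 + w2 ^+ 2) / (w1 * w2).
Proof.
move: m m0 (m_sqr hmu) => k k0 k2; rewrite /spread -k2.
have -> : 4 * mu = 2 * k ^+ 2 by rewrite k2; ring.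
by field; rewrite !gt_eqF.
Qed.

(** Parameters in [Ic] see [Rc] inside the range. To the right of [Ic] the low
    frequency [w1] is already too bad: its spread exceeds that at [m * w2], which
    by hypothesis is past the value [turn_sqr / (2 * m)] where the factor is [Rc]
    again. *)
Lemma Rc_le_max_rho q : (mu ^+ 2 + 1) * (w1 * w2) <= 2 * mu * (w1 ^+ 2 + w2 ^+ 2) ->
  0 < q -> Rc mu <= max_rho mu w1 w2 q.
Proof.
move=> h; have half p : ps <= p -> Rc mu <= max_rho mu w1 w2 p.
  move=> hp; have p0 := lt_le_trans ps0 hp.
  have [hp2|hp2] := lerP p (m * w2).
    rewrite max_rho_ge_Rc// hp2 andbT (le_trans _ hp)// ltW//.
    exact: m_lt_pstar.
  apply: le_trans (rho_le_maxl p0); apply: rho_ge_Rc => //.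
  have mw0 : 0 < m * w2 by exact: mulr_gt0.
  have hs : 2 * m * spread w1 (m * w2) <= 2 * m * spread w1 p.
    rewrite ler_pM2l ?mulr_gt0// ltW// spread_lt_p//.
    rewrite -[in ltLHS](m_sqr hmu).
    have h12 : m * w1 < m * w2 by rewrite ltr_pM2l.
    rewrite -exprMn expr2 ltr_pM ?mulr_ge0 ?(ltW m0) ?(ltW hw1)//.
    exact: lt_trans hp2.
  apply: le_trans hs; rewrite spread1_mw2 ler_pdivlMr ?mulr_gt0// /turn_sqr; lra.
move=> q0; have [|hq] := lerP ps q; first exact: half.
rewrite -(max_rho_mirror q0) half//.
exact/ge_mirror/ltW.
Qed.

Lemma spread_pstar2 : spread w2 ps = spread w1 ps.
Proof. by rewrite -{1}mirror_pstar// spread_mirror2. Qed.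

Lemma rho_pstar2 : rho mu w2 ps = rho mu w1 ps.
Proof. by apply: rho_spread => //; exact: spread_pstar2. Qed.

Lemma spread1_incr p q : ps <= p -> p < q -> spread w1 p < spread w1 q.
Proof.
move=> hp pq; have p0 := lt_le_trans ps0 hp; apply: spread_lt_p => //.
have hp2 : ps ^+ 2 <= p * q by rewrite expr2 ler_pM ?(ltW ps0)// (le_trans hp)// ltW.
apply: lt_le_trans hp2; rewrite pstar_sqr// expr2 mulrA ltr_pM2l// !mulr_gt0//.
Qed.

Lemma spread2_le1 q : ps <= q -> spread w2 q <= spread w1 q.
Proof.
move=> hq; have q0 := lt_le_trans ps0 hq; rewrite spread_le_w//.
rewrite mulr_le0 ?subr_le0 ?(ltW hw12)//.
by rewrite (mulrC w2) mulrA -pstar_sqr// lerXn2r// nnegrE ltW.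
Qed.

Lemma spread_pstar_gt : 2 * m < spread w1 ps.
Proof.
rewrite -(spread_m hmu hw1) spread_lt_p ?mulr_gt0//; first exact: m_lt_pstar.
have mw0 : 0 < m * w1 by exact: mulr_gt0.
rewrite -[in ltLHS](m_sqr hmu) -exprMn expr2 ltr_pM2l//; exact: m_lt_pstar.
Qed.

(** The factor falls below [Rc] strictly between the spreads [2 * m] and
    [turn_sqr / (2 * m)]. *)
Lemma rho_pstar_ltE : (rho mu w1 ps < Rc mu) = (2 * m * spread w1 ps < turn_sqr).
Proof.
have sp := spread_pstar_gt; apply/idP/idP => h.
  by rewrite ltNge; apply: contraL h => h; rewrite -leNgt rho_ge_Rc.
rewrite -(rho_m hmu hw1) rho_lt_left ?mulr_gt0// spread_m//.
Qed.

(** If the factor at [(w1, ps)] is at least [Rc], its spread is already on the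
    increasing branch, and it grows further as the parameter moves to the right
    of [ps]. *)
Lemma max_rho_pstar_lt q : Rc mu <= rho mu w1 ps -> 0 < q -> q != ps ->
  max_rho mu w1 w2 ps < max_rho mu w1 w2 q.
Proof.
move=> hR.
have half p : ps < p -> max_rho mu w1 w2 ps < max_rho mu w1 w2 p.
  move=> hp; have p0 := lt_trans ps0 hp.
  apply: (@le_lt_trans _ _ (rho mu w1 ps)).
    by apply: max_rho_le_Rc => //; rewrite rho_pstar2.
  apply: lt_le_trans (rho_le_maxl p0).
  have sp := spread1_incr (lexx _) hp; apply: rho_lt_right => //.
  move: hR; rewrite leNgt rho_pstar_ltE -leNgt => /le_lt_trans; apply.
  by rewrite ltr_pM2r ?(lt_trans spread_pstar_gt)// spread_gt0.
move=> q0 /lt_total/orP[hq|]; last exact: half.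
rewrite -(max_rho_mirror q0) half//.
by rewrite -{1}mirror_pstar mirror_lt.
Qed.

(** When both ends of the range are strictly below [Rc] at [ps], the maximum
    stays equal to its lower bound [Rc] under small changes of the parameter. *)
Lemma pstar_nbhs : 2 * m * spread w1 ps < turn_sqr ->
  (mu ^+ 2 + 1) * (w1 * w2) <= 2 * mu * (w1 ^+ 2 + w2 ^+ 2) ->
  exists a b : R, [/\ a < ps, ps < b &
    forall p : R, p \in `[a, b] -> minimizes mu w1 w2 p].
Proof.
move=> hs hk.
(* Moving from [ps] to [ps + e] adds at most [e / w1] to the spread at [w1];
   this [e] uses up the whole margin left below [turn_sqr / (2 * m)]. *)
pose e := w1 * (turn_sqr / (2 * m) - spread w1 ps).
have m20 : 0 < 2 * m by exact: mulr_gt0.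
have e0 : 0 < e by rewrite mulr_gt0// subr_gt0 ltr_pdivlMr// mulrC.
have psb : ps < ps + e by rewrite ltrDl.
have half p : ps <= p -> p <= ps + e -> max_rho mu w1 w2 p <= Rc mu.
  move=> hp hpe; have p0 := lt_le_trans ps0 hp.
  have h1 : 2 * m * spread w1 p <= turn_sqr.
    rewrite mulrC -ler_pdivlMr//.
    have -> : turn_sqr / (2 * m) = spread w1 ps + e / w1.
      have -> : e / w1 = turn_sqr / (2 * m) - spread w1 ps.
        by rewrite /e [LHS]mulrC mulKf// gt_eqF.
      by rewrite addrC subrK.
    have -> : spread w1 ps + e / w1 = (ps + e) / w1 + 2 * mu * w1 / ps.
      by rewrite /spread (mulrDl ps) addrAC.
    rewrite lerD ?ler_pM2r ?invr_gt0// ler_pM2l ?mulr_gt0// lef_pV2 ?posrE//.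
  apply: max_rho_le_Rc => //; apply: rho_le_Rc => //.
  by apply: le_trans h1; rewrite ler_pM2l// spread2_le1.
exists (mirror (ps + e)), (ps + e); split => //.
  exact: mirror_lt_pstar.
move=> p; rewrite in_itv /= => /andP[pa pb].
have p0 : 0 < p by apply: lt_le_trans pa; rewrite mirror_gt0// addr_gt0.
split=> // q q0; apply: le_trans (Rc_le_max_rho hk q0).
have [hp|hp] := lerP ps p; first exact: half.
rewrite -(max_rho_mirror p0) half//; first exact/ge_mirror/ltW.
have pse0 : 0 < ps + e by rewrite addr_gt0.
rewrite -(mirrorK pse0) le_eqVlt.
move: pa; rewrite le_eqVlt => /predU1P[<-|pa]; first by rewrite eqxx.
by rewrite mirror_lt ?orbT// mirror_gt0.
Qed.

(** Squaring, and using [spread w1 ps ^+ 2 = 2 * mu * (w1 + w2) ^+ 2 / (w1 * w2)],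
    the hypothesis bounds the square of the left-hand side by
    [8 * mu * turn_sqr], which is less than [turn_sqr ^+ 2] because [mu > 2 + sqrt 3]. *)
Lemma spread_pstar_lt : mu * (w1 ^+ 2 + w2 ^+ 2) <= (mu - 1) ^+ 2 * (w1 * w2) ->
  2 * m * spread w1 ps < turn_sqr.
Proof.
move=> h; have c8 := turn_sqr_gt hmu.
have c0 : 0 < turn_sqr by apply: lt_trans c8; rewrite mulr_gt0.
have s0 := spread_gt0 hmu hw1 ps0.
rewrite -(ltr_pXn2r (n := 2))// ?nnegrE ?(ltW c0) ?mulr_ge0 ?(ltW s0) ?(ltW m0)//.
have -> : (2 * m * spread w1 ps) ^+ 2 =
    16 * mu ^+ 2 * (w1 + w2) ^+ 2 / (w1 * w2).
  rewrite exprMn exprMn m_sqr//.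
  have -> : spread w1 ps ^+ 2 = (ps ^+ 2 + 2 * mu * w1 ^+ 2) ^+ 2 / (w1 ^+ 2 * ps ^+ 2).
    by rewrite /spread; field; rewrite !gt_eqF.
  by rewrite pstar_sqr//; field; rewrite !gt_eqF.
rewrite ltr_pdivrMr ?mulr_gt0//.
have ww : 0 < w1 * w2 by exact: mulr_gt0.
apply: (@le_lt_trans _ _ (8 * mu * turn_sqr * (w1 * w2))).
  have -> : 8 * mu * turn_sqr * (w1 * w2) =
     16 * mu * ((mu - 1) ^+ 2 * (w1 * w2) + 2 * mu * (w1 * w2)).
    by rewrite /turn_sqr; ring.
  have -> : 16 * mu ^+ 2 * (w1 + w2) ^+ 2 =
     16 * mu * (mu * (w1 ^+ 2 + w2 ^+ 2) + 2 * mu * (w1 * w2)) by ring.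
  by rewrite ler_pM2l ?mulr_gt0// lerD2r.
by rewrite ltr_pM2r// expr2 ltr_pM2r.
Qed.

(** * The quartic equation and equioscillation *)

Lemma quartic_spread p : 0 < p ->
  quartic mu w1 w2 p =
  (spread w1 p * spread w2 p - turn_sqr) * (p ^+ 2 * w1 * w2 / 2).
Proof.
move=> p0; rewrite /quartic /spread /turn_sqr; field.
by rewrite !gt_eqF.
Qed.

Lemma quartic_eq0_spread p : 0 < p ->
  quartic mu w1 w2 p = 0 <-> spread w1 p * spread w2 p = turn_sqr.
Proof.
move=> p0; rewrite quartic_spread//.
have W0 : p ^+ 2 * w1 * w2 / 2 != 0 by rewrite gt_eqF// !mulr_gt0// exprn_gt0.
split=> [/eqP|->]; last by rewrite subrr mul0r.
by rewrite mulf_eq0 (negPf W0) orbF subr_eq0 => /eqP.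
Qed.

(** A quadratic equation in [p ^+ 2] whose roots have product [ps ^+ 4], so that
    its positive solutions are mirror images. They are real and distinct because
    the bound on the ratio makes the middle coefficient less than [- ps ^+ 2]. *)
Lemma quartic_factor :
  2 * mu * (w1 ^+ 2 + w2 ^+ 2) <= (mu ^+ 2 + 1) * (w1 * w2) ->
  exists2 pr, ps < pr & forall p,
    quartic mu w1 w2 p = (p ^+ 2 - pr ^+ 2) * (p ^+ 2 - mirror pr ^+ 2) / 2.
Proof.
move=> h; pose b := (mu * w2 - w1) * (w2 - mu * w1).
have ww : 0 < w1 * w2 by exact: mulr_gt0.
have c0 : 0 < 2 * mu * w1 * w2 by rewrite !mulr_gt0.
have bneg : 2 * mu * w1 * w2 < - b.
  have := mulr_gt0 (mu_poly_gt0 hmu) ww; rewrite /b; lra.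
have D0 : 0 < b ^+ 2 - (2 * mu * w1 * w2) ^+ 2.
  rewrite subr_sqr nmulr_rgt0; lra.
have s0 : 0 < Num.sqrt (b ^+ 2 - (2 * mu * w1 * w2) ^+ 2) by rewrite sqrtr_gt0.
have s2 := sqr_sqrtr (ltW D0); move: (Num.sqrt _) s0 s2 => s s0 s2.
have X0 : 2 * mu * w1 * w2 < - b + s by lra.
have X0' := lt_trans c0 X0.
exists (Num.sqrt (- b + s)); first by rewrite ltr_sqrt.
move=> p; rewrite /Defs.quartic -/b exprMn exprVn sqr_sqrtr ?(ltW X0')//.
have -> : (2 * mu * w1 * w2) ^+ 2 = (- b + s) * (- b - s).
  by move: s2; lra.
rewrite [(- b + s) * _ / _]mulrAC divff ?gt_eqF// mul1r.
have -> : 2 * mu ^+ 2 * w1 ^+ 2 * w2 ^+ 2 = ((- b) ^+ 2 - s ^+ 2) / 2.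
  by rewrite s2; field.
by field.
Qed.

Lemma spread2_incr p q : m * w2 <= p -> p < q -> spread w2 p < spread w2 q.
Proof.
move=> hp pq; have mw : 0 < m * w2 by exact: mulr_gt0.
have p0 : 0 < p by exact: lt_le_trans hp.
apply: spread_lt_p => //; rewrite -[in ltLHS](m_sqr hmu) -exprMn.
apply: (@le_lt_trans _ _ (p ^+ 2)); first by rewrite lerXn2r// nnegrE ltW.
by rewrite expr2 ltr_pM2l.
Qed.

(** In this section [pr] is a parameter not left of any point of [Ic] at which the
    two ends of the range have the same factor, [w2] on the decreasing branch and
    [w1] on the increasing one. *)
Section Equioscillation.
Variable pr : R.
Hypothesis pr_ge : m * w2 <= pr.
Hypothesis pr_eq : spread w1 pr * spread w2 pr = turn_sqr.

Let pr_gt : ps < pr := lt_le_trans pstar_lt_m pr_ge.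
Let pr0 : 0 < pr := lt_trans ps0 pr_gt.

Lemma spread2_le_turn : spread w2 pr ^+ 2 <= turn_sqr.
Proof.
by rewrite -pr_eq expr2 ler_pM2r ?spread_gt0// spread2_le1// ltW.
Qed.

Lemma turn_le_spread1 : turn_sqr <= spread w1 pr ^+ 2.
Proof.
by rewrite -pr_eq expr2 ler_pM2l ?spread_gt0// spread2_le1// ltW.
Qed.

Lemma rho_pr_eq : rho mu w1 pr = rho mu w2 pr.
Proof. by apply/(rho_eqP hmu) => //; right. Qed.

Lemma max_rho_pr : max_rho mu w1 w2 pr = rho mu w2 pr.
Proof.
apply/eqP; rewrite eq_le rho_le_maxr// andbT.
by apply: max_rho_le_ends => //; rewrite rho_pr_eq.
Qed.

Lemma rho_pr_le_Rc : rho mu w2 pr <= Rc mu.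
Proof.
apply: rho_le_Rc => //; apply: le_trans spread2_le_turn.
by rewrite expr2 ler_pM2r ?spread_gt0// spread_ge.
Qed.

Lemma rho_pr_lt_Rc : m * w2 < pr -> rho mu w2 pr < Rc mu.
Proof.
move=> h; have hs := spread2_incr (lexx _) h; rewrite -(rho_m hmu w20).
apply: rho_lt_left; rewrite ?mulr_gt0//; apply: lt_le_trans spread2_le_turn.
by rewrite expr2 ltr_pM2r ?spread_gt0.
Qed.

(** Inside [Ic] the maximum is at least [Rc]. Between [Ic] and [pr] the spread at
    [w2] is smaller than at [pr], farther from the turning point, so the factor
    at [w2] is larger; beyond [pr] the same happens at [w1] on the other side of
    the turning point. *)
Lemma max_rho_gt_pr q : ps <= q -> q != pr ->
  Rc mu <= max_rho mu w1 w2 q \/ rho mu w2 pr < max_rho mu w1 w2 q.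
Proof.
move=> hq; have q0 := lt_le_trans ps0 hq.
have [hm _|hm] := lerP q (m * w2).
  left; apply: max_rho_ge_Rc => //; rewrite hm andbT (le_trans _ hq)// ltW//.
  exact: m_lt_pstar.
move=> /lt_total/orP[h|h]; right.
  apply: lt_le_trans (rho_le_maxr q0).
  have hs := spread2_incr (ltW hm) h; apply: rho_lt_left => //.
  by apply: lt_le_trans spread2_le_turn; rewrite expr2 ltr_pM2r ?spread_gt0.
apply: lt_le_trans (rho_le_maxl q0); rewrite -rho_pr_eq.
have hs := spread1_incr (ltW pr_gt) h; apply: rho_lt_right => //.
by apply: le_lt_trans turn_le_spread1 _; rewrite expr2 ltr_pM2r ?spread_gt0.
Qed.

Lemma minimizes_pr : minimizes mu w1 w2 pr.
Proof.
split=> //; have half p : ps <= p -> max_rho mu w1 w2 pr <= max_rho mu w1 w2 p.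
  move=> hp; have [->//|npr] := eqVneq p pr; rewrite max_rho_pr.
  have [h|/ltW//] := max_rho_gt_pr hp npr.
  exact: le_trans rho_pr_le_Rc h.
move=> q q0; have [|hq] := lerP ps q; first exact: half.
rewrite -(max_rho_mirror q0) half//.
exact/ge_mirror/ltW.
Qed.

(** The strict inequality excludes the case where the common value at [pr] equals
    [Rc], in which a parameter in [Ic] could do as well. *)
Lemma minimizes_pr_unique q : m * w2 < pr -> minimizes mu w1 w2 q ->
  q = pr \/ q = mirror pr.
Proof.
move=> hm; have half p : ps <= p -> minimizes mu w1 w2 p -> p = pr.
  move=> hp [_ /(_ _ pr0)]; rewrite max_rho_pr => h.
  apply/eqP; apply: contraTT h => /(max_rho_gt_pr hp) [] h; rewrite -ltNge//.
  exact: lt_le_trans (rho_pr_lt_Rc hm) h.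
move=> hq; have q0 : 0 < q by case: hq.
have [h|h] := lerP ps q; first by left; exact: half.
right; rewrite -(half (mirror q)) ?mirrorK//; last exact: minimizes_mirror.
exact/ge_mirror/ltW.
Qed.

Lemma pr_in_Ir : pr \in Ir mu w2.
Proof.
rewrite in_itv /= pr_ge /=.
have /andP[_ h] := spread_sqr_le hmu w20 pr0 spread2_le_turn.
have a0 : 0 <= (mu - 1) ^+ 2 + delta mu by rewrite addr_ge0 ?sqr_ge0 ?sqrtr_ge0.
rewrite -(ler_pXn2r (n := 2))// ?nnegrE ?(ltW pr0) ?mulr_ge0 ?(ltW w20) ?sqrtr_ge0//.
by rewrite exprMn sqr_sqrtr// mulrC.
Qed.

Lemma mirror_pr_in_Il : mirror pr \in Il mu w1.
Proof.
have rp0 := mirror_gt0 pr0.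
have /andP[h _] : ((mu - 1) ^+ 2 - delta mu) * w1 ^+ 2 <= mirror pr ^+ 2 <=
  ((mu - 1) ^+ 2 + delta mu) * w1 ^+ 2.
  by apply: spread_sqr_le => //; rewrite spread_mirror1// spread2_le_turn.
have a0 : 0 <= (mu - 1) ^+ 2 - delta mu by rewrite subr_ge0 ltW// delta_lt.
rewrite in_itv /=; apply/andP; split.
  rewrite -(ler_pXn2r (n := 2))// ?nnegrE ?(ltW rp0) ?mulr_ge0 ?(ltW hw1) ?sqrtr_ge0//.
  by rewrite exprMn sqr_sqrtr// mulrC.
have mw0 : 0 < m * w2 by exact: mulr_gt0.
have <- : mirror (m * w2) = m * w1.
  move: m m0 (m_sqr hmu) => k k0 k2; rewrite /mirror -k2; field.
  by rewrite !gt_eqF.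
have [<-//|npr] := eqVneq (m * w2) pr.
by rewrite ltW// mirror_lt// lt_neqAle npr.
Qed.

End Equioscillation.

(** Equal factors mean equal spreads or spreads with product [turn_sqr]; the
    spreads at [w1] and [w2] agree only at the fixed point [ps]. *)
Lemma rho_eq_quartic p : 0 < p -> p != ps ->
  rho mu w1 p = rho mu w2 p <-> quartic mu w1 w2 p = 0.
Proof.
move=> p0 pps; rewrite quartic_eq0_spread//.
split=> [/(rho_eqP hmu hw1 p0 w20 p0)[e|//]|e]; last first.
  by apply/(rho_eqP hmu) => //; right.
have : (w2 - w1) * (2 * mu * (w1 * w2) - p ^+ 2) == 0.
  by rewrite eq_le -spread_le_w// e lexx andbT -oppr_ge0 -mulNr opprB
    (mulrC w1) -spread_le_w// e.
rewrite mulf_eq0 subr_eq0 gt_eqF//= subr_eq0 mulrA -pstar_sqr// eqrXn2 ?ltW//.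
by rewrite eq_sym (negPf pps).
Qed.

Lemma quartic_factor_eq0 pr p : 0 < pr -> 0 < p ->
  (forall q, quartic mu w1 w2 q = (q ^+ 2 - pr ^+ 2) * (q ^+ 2 - mirror pr ^+ 2) / 2) ->
  quartic mu w1 w2 p = 0 <-> p = mirror pr \/ p = pr.
Proof.
move=> pr0 p0 ->; have rp0 := mirror_gt0 pr0.
split=> [/eqP|[->|->]]; last by rewrite subrr !mul0r.
  rewrite !mulf_eq0 invr_eq0 pnatr_eq0 orbF !subr_eq0 !eqrXn2 ?ltW//.
  by case/orP => /eqP; [right|left].
by rewrite subrr mulr0 mul0r.
Qed.

Lemma quartic_m_w2 : quartic mu w1 w2 (m * w2) =
  2 * mu * w2 ^+ 2 *
  (2 * mu * (w1 ^+ 2 + w2 ^+ 2) - (mu ^+ 2 + 1) * (w1 * w2)).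
Proof.
rewrite /Defs.quartic.
have -> : (m * w2) ^+ 4 = ((m * w2) ^+ 2) ^+ 2 by rewrite -exprM.
have -> : (m * w2) ^+ 2 = 2 * mu * w2 ^+ 2 by rewrite exprMn (m_sqr hmu).
by field.
Qed.

(** The quartic is negative exactly between its two positive roots, and
    [m * w2 > ps] lies to the right of the smaller one: so its sign at [m * w2],
    which is that of the left-hand side, tells on which side of [pr] this point
    is. With [h1_sign] it turns the threshold [h1] into the position of [pr]
    relative to [Ic]. *)
Lemma m_w2_sign pr : ps < pr ->
  (forall q, quartic mu w1 w2 q = (q ^+ 2 - pr ^+ 2) * (q ^+ 2 - mirror pr ^+ 2) / 2) ->
  exists2 K, 0 < K &
  2 * mu * (w1 ^+ 2 + w2 ^+ 2) - (mu ^+ 2 + 1) * (w1 * w2) = K * (m * w2 - pr).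
Proof.
move=> hp hq; have pr0 := lt_trans ps0 hp.
have rp0 := mirror_gt0 pr0.
have rps : mirror pr < ps by exact: mirror_lt_pstar.
have mw0 : 0 < m * w2 by exact: mulr_gt0.
have c0 : 0 < 2 * mu * w2 ^+ 2 by rewrite mulr_gt0 ?exprn_gt0// mulr_gt0.
exists ((2 * mu * w2 ^+ 2)^-1 * (((m * w2) ^+ 2 - mirror pr ^+ 2) / 2 * (m * w2 + pr))).
  rewrite mulr_gt0 ?invr_gt0// mulr_gt0 ?addr_gt0// divr_gt0// subr_gt0.
  rewrite ltr_pXn2r// ?nnegrE ?ltW//.
  by rewrite (lt_trans rps)// pstar_lt_m.
apply: (mulfI (lt0r_neq0 c0)); rewrite -quartic_m_w2 hq.
by field; rewrite !gt_eqF.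
Qed.

End Range.

(** * The optimized parameters *)

Unset Implicit Arguments.
Set Strict Implicit.

Theorem theorem3p3 (R : realType) (w1 w2 mu : R)
    (hw1 : 0 < w1) (hw12 : w1 < w2) (hmu : 2 + Num.sqrt 3 < mu) :
  let ps := Num.sqrt (2 * mu * w1 * w2) in
  let kr := w2 / w1 in
  [/\ (* (i) *)
      h2 mu < kr ->
        [/\ ps \in Ic mu w1 w2,
            minimizes mu w1 w2 ps,
            Rc mu <= rho mu w1 ps ->
              forall p : R, minimizes mu w1 w2 p -> p = ps
          & rho mu w1 ps < Rc mu ->
              exists a b : R, [/\ a < ps, ps < b &
                forall p : R, p \in `[a, b] -> minimizes mu w1 w2 p]],
      (* (ii) *)
      h1 mu < kr -> kr <= h2 mu ->
        exists a b : R, [/\ a < ps, ps < b &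
          forall p : R, p \in `[a, b] -> minimizes mu w1 w2 p]
    & (* (iii) *)
      kr <= h1 mu ->
        exists pl pr : R,
          [/\ pl != pr,
              minimizes mu w1 w2 pl /\ minimizes mu w1 w2 pr,
              kr < h1 mu ->
                forall p : R, minimizes mu w1 w2 p -> p = pl \/ p = pr,
              [/\ pl \in Il mu w1,
                  forall p : R, p \in Il mu w1 ->
                    (rho mu w1 p = rho mu w2 p <-> p = pl),
                  pr \in Ir mu w2
                & forall p : R, p \in Ir mu w2 ->
                    (rho mu w1 p = rho mu w2 p <-> p = pr)]
            & forall p : R, 0 < p ->
                (quartic mu w1 w2 p = 0 <-> p = pl \/ p = pr)]].
Proof.
rewrite -/(pstar mu w1 w2) => ps kr.
have ps0 : 0 < ps by exact: pstar_gt0.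
have m0 := m_gt0 hmu.
have w20 := lt_trans hw1 hw12.
have [K1 K10 K1E] := h1_sign hmu hw1 hw12.
have [K2 K20 K2E] := h2_sign hmu hw1 hw12.
have wide : h1 mu < kr ->
    (mu ^+ 2 + 1) * (w1 * w2) <= 2 * mu * (w1 ^+ 2 + w2 ^+ 2).
  by move=> hk; rewrite -subr_ge0 K1E pmulr_rge0// subr_ge0 ltW.
split=> [hk|hk1 hk2|hk].
- (* Doubling the inequality given by [h2 < kr] yields the one needed, since
     [2 * (mu - 1) ^+ 2 - (mu ^+ 2 + 1) = mu ^+ 2 - 4 * mu + 1 > 0]. *)
  have wide2 : (mu ^+ 2 + 1) * (w1 * w2) <= 2 * mu * (w1 ^+ 2 + w2 ^+ 2).
    have : 0 < mu * (w1 ^+ 2 + w2 ^+ 2) - (mu - 1) ^+ 2 * (w1 * w2).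
      by rewrite K2E pmulr_rgt0// subr_gt0.
    have := mulr_gt0 (mu_poly_gt0 hmu) (mulr_gt0 hw1 w20); lra.
  have nbhs : rho mu w1 ps < Rc mu -> exists a b : R, [/\ a < ps, ps < b &
      forall p : R, p \in `[a, b] -> minimizes mu w1 w2 p].
    by rewrite rho_pstar_ltE// => hs; exact: pstar_nbhs wide2.
  have uniq q : Rc mu <= rho mu w1 ps -> 0 < q -> q != ps ->
      max_rho mu w1 w2 ps < max_rho mu w1 w2 q by exact: max_rho_pstar_lt.
  split=> //.
  + by rewrite in_itv /= (ltW (m_lt_pstar _ _ _)) ?(ltW (pstar_lt_m _ _ _)).
  + have [hR|/nbhs[a [b [ap pb]]]] := lerP (Rc mu) (rho mu w1 ps); last first.
      by apply; rewrite in_itv /= !ltW.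
    split=> // q q0; have [->//|qps] := eqVneq q ps.
    exact/ltW/uniq.
  + move=> hR p [p0 /(_ _ ps0) hp]; apply/eqP; apply: contraTT hp => hp.
    by rewrite -ltNge uniq.
- apply: pstar_nbhs => //; last exact: wide.
  by apply: spread_pstar_lt => //; rewrite -subr_le0 K2E pmulr_rle0// subr_le0.
have hB : 2 * mu * (w1 ^+ 2 + w2 ^+ 2) <= (mu ^+ 2 + 1) * (w1 * w2).
  by rewrite -subr_le0 K1E pmulr_rle0// subr_le0.
have [pr hpr fact] := quartic_factor hmu hw1 hw12 hB.
have [K3 K30 K3E] := m_w2_sign hmu hw1 hw12 hpr fact.
have hm : Num.sqrt (2 * mu) * w2 <= pr.
  by rewrite -subr_le0 -(pmulr_rle0 _ K30) -K3E subr_le0.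
have pr0 : 0 < pr by exact: lt_trans hpr.
have pl0 : 0 < mirror mu w1 w2 pr by exact: mirror_gt0.
have hpl : mirror mu w1 w2 pr < ps by exact: mirror_lt_pstar.
have roots p : 0 < p -> quartic mu w1 w2 p = 0 <-> p = mirror mu w1 w2 pr \/ p = pr.
  by move=> p0; exact: quartic_factor_eq0.
have prE : spread mu w1 pr * spread mu w2 pr = turn_sqr mu.
  by apply/(quartic_eq0_spread mu hw1 hw12 pr0)/roots => //; right.
exists (mirror mu w1 w2 pr), pr; split=> //.
- by rewrite lt_eqF// (lt_trans hpl).
- have hmin := minimizes_pr hmu hw1 hw12 hm prE.
  by split=> //; exact: minimizes_mirror.
- move=> hlt p hp.
  have hm' : Num.sqrt (2 * mu) * w2 < pr.
    by rewrite -subr_lt0 -(pmulr_rlt0 _ K30) -K3E K1E pmulr_rlt0// subr_lt0.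
  by have [->|->] := minimizes_pr_unique hmu hw1 hw12 hm prE hm' hp; [right|left].
split.
- exact: mirror_pr_in_Il.
- move=> p; rewrite in_itv /= => /andP[pa pb].
  have p0 : 0 < p.
    by apply: lt_le_trans pa; rewrite mulr_gt0// sqrtr_gt0 subr_gt0 delta_lt.
  have pps : p < ps by exact: le_lt_trans (m_lt_pstar hmu hw1 hw12).
  rewrite rho_eq_quartic// ?lt_eqF// roots//; split=> [[]// e|]; last by left.
  by move: hpr; rewrite -e ltNge ltW.
- exact: (pr_in_Ir hmu hw1 hw12 hm prE).
- move=> p; rewrite in_itv /= => /andP[pa _].
  have pps : ps < p by exact: lt_le_trans (pstar_lt_m hmu hw1 hw12) _.
  have p0 : 0 < p by exact: lt_trans pps.
  rewrite rho_eq_quartic// ?gt_eqF// roots//; split=> [[]// e|]; last by right.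
  by move: hpl; rewrite -e ltNge ltW.
Qed.
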